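(* Let $K$ be a field and let $G$ be a finite simple graph without isolated vertices. Then the ideal $I(X_G)$ is generated by homogeneous binomials.
   Context: Graphs have nonempty vertex set. For a graph $G$ with vertex set $V_G$ and edge set $E_G$, let $K[V_G]=K[x_i: i\in V_G]$ and $K[E_G]=K[t_e: e\in E_G]$ be standard graded polynomial rings, and let $\theta\colon K[E_G]\to K[V_G]$ be the $K$-algebra homomorphism with $\theta(t_e)=x_ix_j$ for each edge $e=\{i,j\}$. The ideal $I(X_G)\subseteq K[E_G]$ is the ideal $I(X_G)=\theta^{-1}\big((x_i^2-x_j^2 : i,j\in V_G)\big)$. A binomial is a difference of two monomials (with coefficient $1$), and the zero ideal is considered to be generated by the empty set of binomials. *)

(* Defs.v *)
From HB Require Import structures.
From mathcomp Require Import all_boot all_order all_algebra.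
From mathcomp Require Export mpoly.

Set Implicit Arguments.
Unset Strict Implicit.
Unset Printing Implicit Defensive.

Import GRing.Theory.
Local Open Scope ring_scope.

(* The smallest ideal containing S: all finite sums \sum_i a_i s_i with the
   s_i in S; it is the zero ideal when S is empty. *)
Definition ideal_generated (R : comNzRingType) (S : R -> Prop) (p : R) : Prop :=
  exists2 c : seq (R * R),
    forall u, u \in c -> S u.2 & p = \sum_(u <- c) u.1 * u.2.

Definition is_homogeneous (K : fieldType) (n : nat) (p : {mpoly K[n]}) : Prop :=
  exists d : nat, p \is d.-homog.

Definition is_binomial (K : fieldType) (n : nat) (p : {mpoly K[n]}) : Prop :=
  exists m1 m2 : 'X_{1..n}, m1 != m2 /\ p = 'X_[m1] - 'X_[m2].

Section Graph.

(* A finite simple graph is a symmetric irreflexive relation e on a finType V;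
   these two properties are hypotheses of the statements using e. *)
Variables (K : fieldType) (V : finType) (e : rel V).

Definition edges : {set {set V}} :=
  [set A : {set V} | [exists i, exists j, e i j && (A == [set i; j])]].

Definition vertex_var (i : V) : {mpoly K[#|V|]} := 'X_(enum_rank i).

(* For e irreflexive, an edge {i, j} has i != j and the product is x_i * x_j;
   the variable t_k of K[E_G] stands for the k-th edge, enum_val k. *)
Definition edge_monomial (k : 'I_#|edges|) : {mpoly K[#|V|]} :=
  \prod_(i in enum_val k) vertex_var i.

Definition theta (f : {mpoly K[#|edges|]}) : {mpoly K[#|V|]} :=
  f \mPo [tuple edge_monomial k | k < #|edges|].

Definition square_difference (g : {mpoly K[#|V|]}) : Prop :=
  exists i j : V, g = vertex_var i ^+ 2 - vertex_var j ^+ 2.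

Definition ideal_XG (f : {mpoly K[#|edges|]}) : Prop :=
  ideal_generated square_difference (theta f).

End Graph.

Arguments theta K {V} e f.
Arguments square_difference K V g : clear implicits.
Arguments ideal_XG K {V} e f.

(* Main.v *)
Require Import Defs.
From HB Require Import structures.
From mathcomp Require Import all_boot all_order all_algebra.
From mathcomp Require Import mpoly.
From mathcomp Require Import ring zify.

Import GRing.Theory.

Local Open Scope ring_scope.

(** The ideal [(x_i^2 - x_j^2)] identifies two monomials exactly when they have
    the same degree and the same exponents modulo 2.  Hence the binomials
    [t^a - t^b] whose images under [theta] are identified lie in [I(X_G)], and
    they are homogeneous since [theta] doubles degrees.  Conversely, summing
    coefficients over one class of monomials is a linear form vanishing on
    [(x_i^2 - x_j^2)]; so if [f] lies in [I(X_G)], the coefficients of [f] over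
    each class add up to zero, and subtracting from every monomial of [f] a
    representative of its class writes [f] as a combination of these binomials. *)

(** * Ideals given by generators, and congruence modulo them *)

Section GeneratedIdeals.

Context {R : comNzRingType}.
Implicit Types (S : R -> Prop) (p q : R).

Lemma ideal_generated0 S : ideal_generated S 0.
Proof. by exists [::]; rewrite ?big_nil. Qed.

Lemma ideal_generatedD S p q :
  ideal_generated S p -> ideal_generated S q -> ideal_generated S (p + q).
Proof.
move=> [c Sc ->] [d Sd ->]; exists (c ++ d); last by rewrite big_cat.
by move=> u; rewrite mem_cat => /orP[/Sc|/Sd].
Qed.

Lemma ideal_generatedM S p q :
  ideal_generated S q -> ideal_generated S (p * q).
Proof.
move=> [c Sc ->]; exists [seq (p * u.1, u.2) | u <- c].
  by move=> _ /mapP[u /Sc Su ->].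
by rewrite big_map mulr_sumr; apply: eq_bigr => u _; rewrite mulrA.
Qed.

Lemma ideal_generated_gen S p : S p -> ideal_generated S p.
Proof.
move=> Sp; exists [:: (1, p)]; last by rewrite big_seq1 mul1r.
by move=> u; rewrite inE => /eqP->.
Qed.

Lemma ideal_generated_sum S (I : eqType) (r : seq I) (F : I -> R) :
  (forall i, i \in r -> ideal_generated S (F i)) ->
  ideal_generated S (\sum_(i <- r) F i).
Proof.
move=> SF; rewrite big_seq; apply: big_ind => //; last exact: ideal_generatedD.
exact: ideal_generated0.
Qed.

(** Read as a congruence between [p] and [q], membership of [p - q] in the ideal is compatible with
    products; this is used below to compare monomials factor by factor. *)
Lemma ideal_generated_subM S p1 p2 q1 q2 :
  ideal_generated S (p1 - q1) -> ideal_generated S (p2 - q2) ->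
  ideal_generated S (p1 * p2 - q1 * q2).
Proof.
move=> S1 S2; have -> : p1 * p2 - q1 * q2 = p1 * (p2 - q2) + q2 * (p1 - q1).
  by ring.
by apply: ideal_generatedD; apply: ideal_generatedM.
Qed.

Lemma ideal_generated_subX S p q k :
  ideal_generated S (p - q) -> ideal_generated S (p ^+ k - q ^+ k).
Proof.
by move=> Spq; rewrite subrXX mulrC; apply: ideal_generatedM.
Qed.

Lemma ideal_generated_sub_prod S (I : finType) (F G : I -> R) :
  (forall i, ideal_generated S (F i - G i)) ->
  ideal_generated S (\prod_i F i - \prod_i G i).
Proof.
move=> SFG; elim/big_ind2: _ => //; first by rewrite subrr; apply: ideal_generated0.
by move=> *; apply: ideal_generated_subM.
Qed.

End GeneratedIdeals.

(** * Parity classes of monomials and the linear forms they define *)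

Section ParityClasses.

Context {K : fieldType} {n : nat}.
Implicit Types (m : 'X_{1..n}) (p : {mpoly K[n]}).

Definition parity_class m : nat * {ffun 'I_n -> bool} :=
  (mdeg m, [ffun i => odd (m i)]).

Lemma parity_class_double m i j :
  parity_class (m + U_(i) *+ 2)%MM = parity_class (m + U_(j) *+ 2)%MM.
Proof.
congr pair; first by rewrite !mdegD !mdeg1.
by apply/ffunP => k; rewrite !ffunE !mnmDE !oddD !addbb.
Qed.

(** The first component of [c] is the degree, so the bound [c.1.+1] keeps the sum finite without
    losing any monomial of the class. *)
Definition class_sum c p : K :=
  \sum_(m : 'X_{1..n < c.1.+1} | parity_class m == c) p@_m.

Lemma class_sum_is_linear c : linear_for *%R (class_sum c).
Proof.
move=> a p q; rewrite /class_sum mulr_sumr -big_split /=.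
by apply: eq_bigr => m _; rewrite mcoeffD mcoeffZ.
Qed.

HB.instance Definition _ c :=
  GRing.isLinear.Build K {mpoly K[n]} K *%R (class_sum c) (class_sum_is_linear c).

Lemma class_sumX c m : class_sum c 'X_[m] = (parity_class m == c)%:R.
Proof.
rewrite /class_sum; case: eqP => [<-|nc]; last first.
  by rewrite big1 // => m' /eqP mc; rewrite mcoeffX; case: eqP => // mm'; case: nc; rewrite mm'.
have mP : (mdeg m < (parity_class m).1.+1)%N by [].
rewrite (bigD1 (BMultinom mP)) //= mcoeffX eqxx big1 ?addr0 // => m' /andP[_ nm].
by rewrite mcoeffX; case: eqP => // mm'; case/eqP: nm; apply: val_inj.
Qed.

(** By linearity [p] may be taken to be a monomial; its products with the two squares lie in one
    class, so their contributions cancel. *)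
Lemma class_sum_square_difference c p i j :
  class_sum c (p * ('X_i ^+ 2 - 'X_j ^+ 2)) = 0.
Proof.
elim/mpolyind: p => [|a m p _ _ IHp]; first by rewrite mul0r linear0.
rewrite mulrDl linearD /= IHp addr0 -scalerAl linearZ /= mulrBr linearB /=.
rewrite !mpolyXn -!mpolyXD !class_sumX.
by rewrite (parity_class_double m i j) subrr mulr0.
Qed.

End ParityClasses.

(** * Congruence of monomials modulo the differences of squares *)

Section Graph.

Context {K : fieldType} {V : finType}.

Local Notation J := (ideal_generated (square_difference K V)).

(** Every even power is moved onto the base vertex [v], as each square is congruent to that of [v].
    The resulting normal form depends only on the parity class of [m]. *)
Lemma mpolyX_reduce (v : V) (m : 'X_{1..#|V|}) :
  J ('X_[m] - (\prod_i 'X_i ^+ odd (m i)) *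
              vertex_var K v ^+ (mdeg m - \sum_i odd (m i))%N).
Proof.
have -> : (mdeg m - \sum_i odd (m i) = \sum_i (2 * (m i)./2))%N.
  rewrite mdegE (eq_bigr (fun i => odd (m i) + 2 * (m i)./2)%N); last by move=> i _; lia.
  by rewrite big_split addKn.
(* The power of the variable of [v] is spread over all [i], which leaves one congruence for each
   variable. *)
rewrite -prodrXr -big_split /= mpolyXE_id.
apply: ideal_generated_sub_prod => i.
rewrite -{1}(odd_double_half (m i)) -mul2n exprD.
apply: ideal_generated_subM; first by rewrite subrr; apply: ideal_generated0.
rewrite !exprM; apply/ideal_generated_subX/ideal_generated_gen.
by exists (enum_val i), v; rewrite /vertex_var enum_valK.
Qed.

Lemma parity_class_cong (v : V) (m1 m2 : 'X_{1..#|V|}) :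
  parity_class m1 = parity_class m2 -> J ('X_[m1] - 'X_[m2]).
Proof.
move=> [deg12 /ffunP odd12]; have R1 := mpolyX_reduce v m1.
have R2 := mpolyX_reduce v m2.
have {}odd12 i : odd (m1 i) = odd (m2 i) by have := odd12 i; rewrite !ffunE.
move: R1; rewrite deg12.
under eq_bigr do rewrite odd12; under [X in (_ - X)%N]eq_bigr do rewrite odd12.
(* Both monomials now have the same normal form, which cancels in the difference. *)
move=> /ideal_generatedD /(_ (ideal_generatedM _ (-1) _ R2)).
by congr (J _); ring.
Qed.

Lemma class_sum_ideal0 c (p : {mpoly K[#|V|]}) : J p -> class_sum c p = 0.
Proof.
move=> [s Ss ->]; rewrite linear_sum big_seq big1 // => u /Ss[i [j ->]].
exact: class_sum_square_difference.
Qed.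

(** * The map [theta] on monomials *)

Context {e : rel V}.
Implicit Types a b : 'X_{1..#|edges e|}.

Definition theta_mnm a : 'X_{1..#|V|} :=
  (\sum_(k < #|edges e|) (\sum_(i in enum_val k) U_(enum_rank i)) *+ a k)%MM.

Lemma thetaX a : theta K e 'X_[a] = 'X_[theta_mnm a].
Proof.
rewrite /theta comp_mpolyX /theta_mnm -mprodXE; apply: eq_bigr => k _.
by rewrite tnth_mktuple /edge_monomial /vertex_var mprodXE mpolyXn.
Qed.

Lemma mdeg_theta_mnm a : irreflexive e -> mdeg (theta_mnm a) = (2 * mdeg a)%N.
Proof.
move=> e_irr; rewrite mdeg_sum mdegE big_distrr; apply: eq_bigr => k _ /=.
rewrite mdegMn mdeg_sum; congr (_ * _)%N.
have: enum_val k \in edges e by apply: enum_valP.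
rewrite inE => /existsP[i /existsP[j /andP[eij /eqP->]]].
under eq_bigr do rewrite mdeg1.
(* Only a loop could have fewer than two endpoints. *)
rewrite sum1_card cards2; case: eqP => // ij.
by move: eij; rewrite ij e_irr.
Qed.

Definition edge_class a := parity_class (theta_mnm a).

Lemma class_sum_theta c f :
  class_sum c (theta K e f) = \sum_(a <- msupp f | edge_class a == c) f@_a.
Proof.
rewrite /theta comp_mpolyEX linear_sum [RHS]big_mkcond; apply: eq_bigr => a _.
rewrite linearZ /= -/(theta K e _) thetaX class_sumX -/(edge_class a).
by case: eqP; rewrite ?mulr1 ?mulr0.
Qed.

(** * The generating binomials and the two inclusions *)

Definition class_binomial (g : {mpoly K[#|edges e|]}) : Prop :=
  exists a1 a2, [/\ a1 != a2, edge_class a1 = edge_class a2 & g = 'X_[a1] - 'X_[a2]].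

Lemma class_binomial_homogeneous g :
  irreflexive e -> class_binomial g -> is_homogeneous g /\ is_binomial g.
Proof.
move=> e_irr [a1 [a2 [neq12 [deg12 _] ->]]]; split; last by exists a1, a2.
have {}deg12 : mdeg a2 = mdeg a1 by move: deg12; rewrite !mdeg_theta_mnm //; lia.
by exists (mdeg a1); apply: rpredB; rewrite dhomogX; apply/eqP.
Qed.

Lemma ideal_XG_class_binomial (v : V) f :
  ideal_generated class_binomial f -> ideal_XG K e f.
Proof.
move=> [s Ss ->]; rewrite /ideal_XG /theta raddf_sum /=.
apply: ideal_generated_sum => u /Ss[a1 [a2 [_ eq12 ->]]].
rewrite -/(theta K e _); have -> : theta K e (u.1 * ('X_[a1] - 'X_[a2])) =
    theta K e u.1 * ('X_[theta_mnm a1] - 'X_[theta_mnm a2]).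
  by rewrite -!thetaX /theta rmorphM rmorphB.
exact/ideal_generatedM/(parity_class_cong v).
Qed.

(** The representative is the first monomial in the support of [f] with the class of [a]; the
    default [a] is never reached when [a] is in the support. *)
Definition class_repr (f : {mpoly K[#|edges e|]}) a :=
  nth a (msupp f) (find (fun b => edge_class b == edge_class a) (msupp f)).

Lemma class_repr_class f a : a \in msupp f -> edge_class (class_repr f a) = edge_class a.
Proof.
move=> fa; apply/eqP; apply: (nth_find a (a := fun b => edge_class b == edge_class a)).
by apply/hasP; exists a.
Qed.

Lemma eq_class_repr f a b : a \in msupp f -> b \in msupp f ->
  (class_repr f a == class_repr f b) = (edge_class a == edge_class b).
Proof.
move=> fa fb; apply/eqP/eqP => [eq_ab | eq_ab].
  by rewrite -(class_repr_class _ _ fa) eq_ab class_repr_class.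
(* The two sides differ only in the default value, and the index is in range. *)
rewrite /class_repr eq_ab; apply: set_nth_default.
by rewrite -has_find; apply/hasP; exists b.
Qed.

(** The coefficient at a representative is the sum of the coefficients of [f] over its class, which
    is [class_sum] of [theta K e f]; no other monomial occurs. *)
Lemma sum_class_repr f : ideal_XG K e f ->
  \sum_(a <- msupp f) f@_a *: 'X_[class_repr f a] = 0 :> {mpoly K[#|edges e|]}.
Proof.
move=> If; apply/mpolyP => b; rewrite mcoeff0 raddf_sum /=.
have [/hasP[a0 fa0 /eqP <-]|/hasPn no_repr] :=
    boolP (has (fun a => class_repr f a == b) (msupp f)); last first.
  rewrite big_seq big1 // => a /no_repr /negPf nb.
  by rewrite mcoeffZ mcoeffX nb mulr0.
rewrite -[RHS](class_sum_ideal0 (edge_class a0) _ If) class_sum_theta.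
rewrite [RHS]big_mkcond !big_seq; apply: eq_bigr => a fa /=.
by rewrite mcoeffZ mcoeffX eq_class_repr //; case: eqP; rewrite ?mulr1 ?mulr0.
Qed.

Lemma class_binomial_ideal_XG f :
  ideal_XG K e f -> ideal_generated class_binomial f.
Proof.
move=> If; rewrite [f]mpolyE -[X in ideal_generated _ X]subr0.
rewrite -[X in _ - X](sum_class_repr f If) -sumrB.
apply: ideal_generated_sum => a fa; rewrite -scalerBr -mul_mpolyC.
(* A monomial that represents its own class gives a zero term, which is not a binomial and is
   treated apart. *)
apply: ideal_generatedM; have [<-|neq_a] := eqVneq a (class_repr f a).
  by rewrite subrr; apply: ideal_generated0.
apply: ideal_generated_gen; exists a, (class_repr f a).
by rewrite class_repr_class.
Qed.

End Graph.

Theorem corollary2p3 (K : fieldType) (V : finType) (e : rel V)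
    (V_nonempty : (0 < #|V|)%N)
    (e_sym : ssrbool.symmetric e) (e_irr : irreflexive e)
    (no_isolated : forall i : V, exists j : V, e i j) :
  exists B : {mpoly K[#|edges e|]} -> Prop,
    (forall b, B b -> is_homogeneous b /\ is_binomial b) /\
    (forall f, ideal_XG K e f <-> ideal_generated B f).
Proof.
have /card_gt0P[v _] := V_nonempty.
exists class_binomial; split=> [b|f]; first exact: class_binomial_homogeneous.
by split; [apply: class_binomial_ideal_XG | apply: (ideal_XG_class_binomial v)].
Qed.
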